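(* Let $\mathbf{X}\in\mathbb{R}^{n\times p}$, $\beta^*\in\mathbb{R}^p$. Let $h:\mathbb{R}^p\to[0,+\infty]$ be a convex, proper function such that the minimization problem $\min_{\beta\in\mathbb{R}^p}\|\mathbf{A}\beta-z\|^2+2h(\beta)$ has at least one solution for every $z\in\mathbb{R}^n$ and every $\mathbf{A}\in\mathbb{R}^{n\times p}$. Assume that $h(\beta^* )<+\infty$. Then for any $\varepsilon\in\mathbb{R}^n$, with $y=\mathbf{X}\beta^*+\varepsilon$ and $\hat\beta\in\operatorname*{argmin}_{\beta\in\mathbb{R}^p}\|\mathbf{X}\beta-y\|^2+2h(\beta)$, we have $$\lim_{t\to+\infty}H(t)=\inf_{t>0}H(t)\ \le\ \|\mathbf{X}(\hat\beta-\beta^* )\|.$$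
   Context: $\|\cdot\|$ is the Euclidean norm. A function is proper if it is finite at at least one point. The function $H:(0,+\infty)\to\mathbb{R}$ (which depends on $\varepsilon$) is defined by $$H(t)=\sup_{\beta\in\mathbb{R}^p:\ \|\mathbf{X}(\beta-\beta^* )\|\le t}\frac{\varepsilon^T\mathbf{X}(\beta-\beta^* )+h(\beta^* )-h(\beta)}{t},\qquad t>0.$$ *)

(* Defs.v *)
From mathcomp Require Import all_boot all_order all_algebra.
From mathcomp Require Import all_classical all_reals all_analysis.

Set Implicit Arguments.
Unset Strict Implicit.
Unset Printing Implicit Defensive.

Import Order.TTheory GRing.Theory Num.Theory.
Import numFieldNormedType.Exports.

Local Open Scope classical_set_scope.
Local Open Scope ring_scope.

(* The canonical norm on matrices in MathComp-Analysis is the sup norm, hence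
   this explicit Euclidean norm. *)
Definition euclid_norm (R : realType) (m : nat) (x : 'cV[R]_m) : R :=
  Num.sqrt (\sum_(i < m) x i 0 ^+ 2).

Definition proper_fun (R : realType) (T : Type) (f : T -> \bar R) : Prop :=
  exists x, f x \is a fin_num.

(* The library's [convex_function] only covers real-valued functions.  For
   nonnegative [f] no sum of opposite infinities can occur below, and since
   [0 * +oo = 0] the endpoint cases t = 0 and t = 1 hold trivially. *)
Definition convex_efun (R : realType) (E : lmodType R) (f : E -> \bar R) :
    Prop :=
  forall (x y : E) (t : R), 0 <= t <= 1 ->
    (f (t *: x + (1 - t) *: y)%R <= t%:E * f x + (1 - t)%R%:E * f y)%E.

Definition argmin (R : realType) (T : Type) (f : T -> \bar R) : set T :=
  [set x | forall y, (f x <= f y)%E].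

Definition penalized_ls (R : realType) (n p : nat) (A : 'M[R]_(n, p))
    (z : 'cV[R]_n) (h : 'cV[R]_p -> \bar R) (b : 'cV[R]_p) : \bar R :=
  ((euclid_norm (A *m b - z) ^+ 2)%R%:E + 2%:E * h b)%E.

(* When [h] is nonnegative and [h bstar] is finite, the numerator is real or
   [-oo] (the latter exactly when [h b = +oo]).  Only [0 < t] is meaningful. *)
Definition noise_H (R : realType) (n p : nat) (X : 'M[R]_(n, p))
    (bstar : 'cV[R]_p) (h : 'cV[R]_p -> \bar R) (eps : 'cV[R]_n) (t : R) :
    \bar R :=
  ereal_sup [set (((eps^T *m (X *m (b - bstar))) 0 0)%R%:E + h bstar - h b)
                   * (t^-1)%R%:E
            | b in [set b | (euclid_norm (X *m (b - bstar)) <= t)%R]]%E.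

(* Main.v *)
Require Import Defs.
From mathcomp Require Import all_boot all_order all_algebra.
From mathcomp Require Import all_classical all_reals all_analysis.
From mathcomp Require Import ring lra.

Set Implicit Arguments.
Unset Strict Implicit.

Import Order.TTheory GRing.Theory Num.Theory.
Import numFieldNormedType.Exports.

Local Open Scope classical_set_scope.
Local Open Scope ring_scope.

(* Write <u, v> for the scalar product, u = X (b - bstar) and
   d = X (bhat - bstar).  Contracting b towards bstar multiplies u by s / t and,
   by convexity, the numerator in H by at least s / t; hence H is nonincreasing
   and its limit is its infimum.  The optimality of bhat along segments gives
   <eps - d, u - d> <= h b - h bhat for all b, so the numerator is at most
   <d, u> + C with C independent of b, and Cauchy-Schwarz yields
   H t <= |d| + C / t. *)

(** Kept as a matrix product, so that the linear term in the numerator of [noise_H] is an instance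
    of it by unfolding. *)
Definition dotv (R : realType) (m : nat) (u v : 'cV[R]_m) : R :=
  (u^T *m v) 0 0.

Section Dotv.
Context (R : realType) (m : nat).
Implicit Types (u v w : 'cV[R]_m) (a : R).

Lemma dotvE u v : dotv u v = \sum_(i < m) u i 0 * v i 0.
Proof. by rewrite /dotv mxE; apply: eq_bigr => i _; rewrite mxE. Qed.

Lemma dotvC u v : dotv u v = dotv v u.
Proof. by rewrite !dotvE; apply: eq_bigr => i _; rewrite mulrC. Qed.

Lemma dotvDr u v w : dotv u (v + w) = dotv u v + dotv u w.
Proof. by rewrite /dotv mulmxDr mxE. Qed.

Lemma dotvZr u a v : dotv u (a *: v) = a * dotv u v.
Proof. by rewrite /dotv -scalemxAr mxE. Qed.

Lemma dotvNr u v : dotv u (- v) = - dotv u v.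
Proof. by rewrite -scaleN1r dotvZr mulN1r. Qed.

Lemma dotvDl u v w : dotv (v + w) u = dotv v u + dotv w u.
Proof. by rewrite dotvC dotvDr !(dotvC u). Qed.

Lemma dotvZl u a v : dotv (a *: v) u = a * dotv v u.
Proof. by rewrite dotvC dotvZr (dotvC u). Qed.

Lemma dotvNl u v : dotv (- v) u = - dotv v u.
Proof. by rewrite dotvC dotvNr (dotvC u). Qed.

Lemma dotv0 u : dotv u 0 = 0.
Proof. by rewrite -(scale0r 0) dotvZr mul0r. Qed.

Lemma dotvv_ge0 u : 0 <= dotv u u.
Proof. by rewrite dotvE; apply: sumr_ge0 => i _; rewrite -expr2 sqr_ge0. Qed.

Lemma dotvv_eq0 u : dotv u u = 0 -> u = 0.
Proof.
rewrite dotvE => u0; apply/colP => i; rewrite mxE.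
have sq_ge0 j : true -> 0 <= u j 0 * u j 0 by rewrite -expr2 sqr_ge0.
by have /eqP := psumr_eq0P sq_ge0 u0 (i := i) isT; rewrite mulf_eq0 orbb => /eqP.
Qed.

Lemma euclid_normE u : euclid_norm u = Num.sqrt (dotv u u).
Proof.
by rewrite /euclid_norm dotvE; congr Num.sqrt; apply: eq_bigr => i _; rewrite expr2.
Qed.

Lemma sqr_euclid_norm u : euclid_norm u ^+ 2 = dotv u u.
Proof. by rewrite euclid_normE sqr_sqrtr ?dotvv_ge0. Qed.

Lemma euclid_norm_ge0 u : 0 <= euclid_norm u.
Proof. exact: sqrtr_ge0. Qed.

Lemma euclid_norm0 : euclid_norm (0 : 'cV[R]_m) = 0.
Proof. by rewrite euclid_normE dotv0 sqrtr0. Qed.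

Lemma euclid_normZ a u : 0 <= a -> euclid_norm (a *: u) = a * euclid_norm u.
Proof.
move=> a0; rewrite !euclid_normE dotvZl dotvZr mulrA -expr2.
by rewrite sqrtrM ?sqr_ge0// sqrtr_sqr ger0_norm.
Qed.

(** Cauchy-Schwarz: for v nonzero, the squared norm of <v, v> u - <u, v> v is nonnegative and equals
    <v, v> (<u, u> <v, v> - <u, v>^2). *)
Lemma dotv_le_norm u v : dotv u v <= euclid_norm u * euclid_norm v.
Proof.
have [->|v0] := eqVneq v 0; first by rewrite dotv0 euclid_norm0 mulr0.
have vv0 : 0 < dotv v v.
  by rewrite lt0r dotvv_ge0 andbT; apply/eqP => /dotvv_eq0/eqP; apply/negP.
apply: le_trans (ler_norm _) _.
rewrite -(@ler_pXn2r _ 2) ?nnegrE ?mulr_ge0 ?euclid_norm_ge0//.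
rewrite real_normK ?num_real// exprMn !sqr_euclid_norm.
have := dotvv_ge0 (dotv v v *: u - dotv u v *: v).
rewrite !(dotvDl, dotvDr, dotvNl, dotvNr, dotvZl, dotvZr) (dotvC v u) => H.
rewrite -(ler_pM2l vv0) -subr_ge0; apply: le_trans H _.
by rewrite le_eqVlt; apply/orP; left; apply/eqP; ring.
Qed.

End Dotv.

(** Monotone convergence applies to functions monotone on the whole line. Extending f by +oo to t <=
    0 keeps it nonincreasing and changes neither the limit nor the infimum. *)
Lemma nonincreasing_pos_cvge (R : realType) (f : R -> \bar R) :
  (forall s t, 0 < s -> s <= t -> (f t <= f s)%E) ->
  f t @[t --> +oo%R] --> ereal_inf [set f t | t in [set t : R | 0 < t]].
Proof.
move=> fni; pose g (t : R) : \bar R := if 0 < t then f t else +oo%E.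
have gf t : 0 < t -> g t = f t by rewrite /g => ->.
have gni : forall s t, s <= t -> (g t <= g s)%E.
  move=> s t st; rewrite {2}/g; case: ifPn => [s0|_]; last exact: leey.
  by rewrite gf ?(lt_le_trans s0)// fni.
have -> : ereal_inf [set f t | t in [set t : R | 0 < t]] = ereal_inf (range g).
  apply/eqP; rewrite eq_le; apply/andP; split.
    apply: le_ereal_inf_tmp => _ [t _ <-]; rewrite /g; case: ifPn => [t0|_].
      by apply: ereal_inf_lbound; exists t.
    exact: leey.
  by apply: le_ereal_inf => _ [t /= t0 <-]; exists t; rewrite ?gf.
suff fg : f t @[t --> +oo%R] `=>` g t @[t --> +oo%R].
  exact: cvg_trans fg (nonincreasing_cvge gni).
apply: near_eq_cvg.
by near=> t; rewrite gf//; near: t; exact: nbhs_pinfty_gt.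
Unshelve. all: by end_near. Qed.

Lemma ge0_slope (R : realType) (a c : R) :
  (forall l, 0 < l <= 1 -> 0 <= a + l * c) -> 0 <= a.
Proof.
move=> H; rewrite leNgt; apply/negP => a0.
(* If a < 0, this l lies in (0, 1] and a + l |c| = - l (1 - a) < 0, a contradiction. *)
pose l := - a / (- a + `|c| + 1).
have c0 := normr_ge0 c.
have D0 : 0 < - a + `|c| + 1 by lra.
have l0 : 0 < l by rewrite divr_gt0//; lra.
have l1 : l <= 1 by rewrite ler_pdivrMr//; lra.
have := H l; rewrite l0 l1 => /(_ isT).
have lc : l * c <= l * `|c| by rewrite ler_pM2l// ler_norm.
have lD : l * (- a + `|c| + 1) = - a by rewrite /l divfK// gt_eqF.
have la : 0 < l * (- a) by rewrite mulr_gt0//; lra.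
by nra.
Qed.

(** First-order optimality along the segment from c to b. Comparing the objective at c with that at
    l b + (1 - l) c, bounding h there by convexity and dividing by 2 l leaves 0 <= hb - hc - <w, v>
    + l |v|^2 / 2; then l tends to 0. *)
Lemma argmin_variational (R : realType) (n p : nat) (X : 'M[R]_(n, p))
    (h : 'cV[R]_p -> \bar R) (z : 'cV[R]_n) (c b : 'cV[R]_p) (hc hb : R) :
  convex_efun h -> argmin (penalized_ls X z h) c ->
  h c = hc%:E -> h b = hb%:E ->
  dotv (z - X *m c) (X *m (b - c)) <= hb - hc.
Proof.
move=> h_convex c_min hcE hbE.
set w := z - X *m c; set v := X *m (b - c).
suff : 0 <= (hb - hc) - dotv w v by rewrite subr_ge0.
apply: (@ge0_slope _ _ (dotv v v / 2)) => l /andP[l0 l1].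
have l01 : 0 <= l <= 1 by rewrite ltW.
have := h_convex b c l l01; rewrite hbE hcE -!EFinM -EFinD => hl.
have := c_min (l *: b + (1 - l) *: c); rewrite /penalized_ls !sqr_euclid_norm.
have -> : X *m (l *: b + (1 - l) *: c) - z = l *: v - w.
  rewrite /v /w mulmxDr -!scalemxAr mulmxBr scalerBl scalerBr scale1r.
  by apply/colP => i; rewrite !mxE; ring.
have -> : X *m c - z = - w by rewrite /w opprB.
rewrite hcE -EFinM -EFinD => hmin.
have two_ge0 : (0 <= 2%:E :> \bar R)%E by rewrite lee_fin.
have {hmin} := le_trans hmin (leeD2l _ (lee_wpmul2l two_ge0 hl)).
rewrite -EFinM -EFinD lee_fin.
move: w v => w v.
rewrite !(dotvDl, dotvDr, dotvNl, dotvNr, dotvZl, dotvZr) (dotvC v w) => hmin.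
rewrite -(ler_pM2l l0); nra.
Qed.

Section NoiseH.
Context (R : realType) (n p : nat) (X : 'M[R]_(n, p)) (bstar : 'cV[R]_p).
Context (h : 'cV[R]_p -> \bar R) (eps : 'cV[R]_n) (hs : R).
Hypothesis h_ge0 : forall b, (0 <= h b)%E.
Hypothesis hsE : h bstar = hs%:E.

(** Points with h b = +oo contribute -oo to the supremum, so only real values of h need a bound. *)
Lemma noise_H_le (t M : R) : 0 < t ->
  (forall b r, euclid_norm (X *m (b - bstar)) <= t -> h b = r%:E ->
     dotv eps (X *m (b - bstar)) + hs - r <= M * t) ->
  (noise_H X bstar h eps t <= M%:E)%E.
Proof.
move=> t0 HM; apply: ge_ereal_sup => _ [b /= bt <-].
rewrite lee_pdivrMr// hsE; case hbE : (h b) => [r| |].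
- by rewrite -EFinM -[leLHS]/((dotv eps (X *m (b - bstar)) + hs - r)%:E) lee_fin; exact: HM.
- exact: leNye.
- by have := h_ge0 b; rewrite hbE.
Qed.

Lemma noise_H_ge (t r : R) (b : 'cV[R]_p) :
  euclid_norm (X *m (b - bstar)) <= t -> h b = r%:E ->
  (((dotv eps (X *m (b - bstar)) + hs - r) / t)%:E <= noise_H X bstar h eps t)%E.
Proof.
by move=> bt hbE; apply: ereal_sup_ubound; exists b => //=; rewrite hsE hbE.
Qed.

(** The point bstar contributes 0, and Cauchy-Schwarz with h >= 0 gives the upper bound |eps| +
    h(bstar) / t. *)
Lemma noise_H_fin_num (t : R) : 0 < t -> noise_H X bstar h eps t \is a fin_num.
Proof.
move=> t0; rewrite fin_numElt; apply/andP; split.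
  apply: lt_le_trans (@noise_H_ge t hs bstar _ hsE); first exact: ltNyr.
  by rewrite subrr mulmx0 euclid_norm0 ltW.
apply: le_lt_trans (@noise_H_le t (euclid_norm eps + hs / t) t0 _) _ => [b r bt hbE|].
  have r0 : 0 <= r by rewrite -lee_fin -hbE.
  rewrite mulrDl divfK ?gt_eqF//.
  have := dotv_le_norm eps (X *m (b - bstar)).
  have := ler_wpM2l (euclid_norm_ge0 eps) bt; lra.
exact: ltry.
Qed.

Hypothesis h_convex : convex_efun h.

Lemma noise_H_nonincreasing (s t : R) : 0 < s -> s <= t ->
  (noise_H X bstar h eps t <= noise_H X bstar h eps s)%E.
Proof.
move=> s0 st; have t0 := lt_le_trans s0 st.
rewrite -(fineK (noise_H_fin_num s0)); apply: noise_H_le => // b r bt hbE.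
pose l := s / t.
have l0 : 0 < l by rewrite divr_gt0.
have l1 : l <= 1 by rewrite ler_pdivrMr// mul1r.
have lt : l * t = s by rewrite divfK// gt_eqF.
have l01 : 0 <= l <= 1 by rewrite ltW.
have := h_convex b bstar l01.
(* The contracted point c is admissible for s = l t. By convexity h c is finite and the numerator at
   c is at least l times the one at b, so the factor l cancels. *)
set c := l *: b + _; rewrite hbE hsE -!EFinM -EFinD => hc.
have hcfin : h c \is a fin_num by rewrite ge0_fin_numE// (le_lt_trans hc) ?ltry.
have cE : X *m (c - bstar) = l *: (X *m (b - bstar)).
  rewrite scalemxAr; congr (_ *m _).
  by apply/colP => i; rewrite !mxE; ring.
have cs : euclid_norm (X *m (c - bstar)) <= s.
  by rewrite cE (euclid_normZ _ (ltW l0)) -lt (ler_pM2l l0).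
have := noise_H_ge cs (esym (fineK hcfin)).
rewrite -{1}(fineK (noise_H_fin_num s0)) lee_fin ler_pdivrMr// cE dotvZr.
move: hc; rewrite -(fineK hcfin) lee_fin -lt => hc Hs.
rewrite -(ler_pM2l l0); nra.
Qed.

End NoiseH.

(** The limit and the infimum are taken in the extended reals; the first clause records that H is
    real-valued on t > 0. *)
Theorem theorem3p1 (R : realType) (n p : nat) (X : 'M[R]_(n, p))
    (bstar : 'cV[R]_p) (h : 'cV[R]_p -> \bar R)
    (h_ge0 : forall b, (0 <= h b)%E)
    (h_convex : convex_efun h)
    (h_proper : proper_fun h)
    (h_argmin : forall (z : 'cV[R]_n) (A : 'M[R]_(n, p)),
      argmin (penalized_ls A z h) !=set0)
    (h_bstar : (h bstar < +oo)%E)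
    (eps y : 'cV[R]_n) (y_def : y = X *m bstar + eps)
    (bhat : 'cV[R]_p) (bhat_argmin : argmin (penalized_ls X y h) bhat) :
  [/\ forall t : R, 0 < t -> noise_H X bstar h eps t \is a fin_num,
      noise_H X bstar h eps t @[t --> +oo%R] -->
        ereal_inf [set noise_H X bstar h eps t | t in [set t : R | 0 < t]] &
      (ereal_inf [set noise_H X bstar h eps t | t in [set t : R | (0 < t)%R]]
        <= (euclid_norm (X *m (bhat - bstar)))%R%:E)%E].
Proof.
have [hs hsE] : exists hs, h bstar = hs%:E.
  by exists (fine (h bstar)); rewrite fineK// ge0_fin_numE.
(* The objective is finite at bstar, hence also at its minimizer bhat. *)
have [hh hhE] : exists hh, h bhat = hh%:E.
  have := bhat_argmin bstar; rewrite /penalized_ls hsE -EFinM -EFinD.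
  case hE : (h bhat) => [r| |] //; first by exists r.
    by rewrite mulry gtr0_sg ?ltr0n// mul1e addey.
  by have := h_ge0 bhat; rewrite hE.
split.
- by move=> t t0; exact: noise_H_fin_num hsE _ t0.
- by apply: nonincreasing_pos_cvge => s t; exact: noise_H_nonincreasing hsE h_convex _ _.
set d := X *m (bhat - bstar).
(* Expanding <eps - d, u - d> <= h b - hh gives <eps, u> + hs - h b <= <d, u> + C. *)
pose C := dotv eps d - dotv d d + hs - hh.
apply/lee_addgt0Pr => e e0.
(* Large enough that C <= e t; the maximum with 1 keeps t positive when C is not. *)
pose t := Num.max 1 (C / e).
have t0 : 0 < t by rewrite lt_max ltr01.
have Cet : C <= e * t by rewrite mulrC -ler_pdivrMr// le_max lexx orbT.
apply: le_trans (ereal_inf_lbound _) _; first by exists t.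
rewrite -EFinD; apply: (noise_H_le h_ge0 hsE t0) => b r bt hbE.
have := argmin_variational h_convex bhat_argmin hhE hbE.
set u := X *m (b - bstar) in bt *.
have -> : y - X *m bhat = eps - d.
  by rewrite y_def /d mulmxBr; apply/colP => i; rewrite !mxE; ring.
have -> : X *m (b - bhat) = u - d.
  by rewrite /u /d !mulmxBr; apply/colP => i; rewrite !mxE; ring.
rewrite !(dotvDl, dotvDr, dotvNl, dotvNr) => var.
(* Since <d, u> <= |d| |u| <= |d| t, the numerator is at most |d| t + C, hence at most (|d| + e)
   t. *)
have := dotv_le_norm d u; have := ler_wpM2l (euclid_norm_ge0 d) bt.
move: Cet; rewrite /C; lra.
Qed.
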